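(* For every integer $k\ge 1$, acting with $\mathrm{fib}^k=\underbrace{\sigma\tau\cdots\sigma\tau}_{k\text{ times}}$ on the slope $\frac{1}{1}$ yields $$\mathrm{fib}^k\left(\frac{1}{1}\right)=\frac{F_{k+1}}{F_k}.$$
   Context: The maps $\sigma$ and $\tau$ act on fractions $\frac{q}{p}$ with $p,q$ positive integers, $\gcd(p,q)=1$, by $\sigma\left(\frac{q}{p}\right)=\frac{p}{q}$ and $\tau\left(\frac{q}{p}\right)=\frac{q}{p+q}$. Products of maps denote composition, with the rightmost map applied first. Define $\mathrm{fib}:=\sigma\tau$ (first $\tau$, then $\sigma$) and let $\mathrm{fib}^k$ be its $k$-fold composition. $F_k$ denotes the Fibonacci numbers with $F_0=F_1=1$ and $F_{k+2}=F_{k+1}+F_k$. *)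

(* Defs.v *)
From mathcomp Require Import all_boot all_order all_algebra.

Set Implicit Arguments.
Unset Strict Implicit.
Unset Printing Implicit Defensive.

Import Order.TTheory GRing.Theory Num.Theory.
Local Open Scope ring_scope.

(* A fraction q/p with p, q positive and gcd(p, q) = 1 is a positive rational
   x, with q = numq x and p = denq x: rat stores the reduced form. *)
Definition slope : Type := {x : rat | 0 < x}.

Definition slope_num (s : slope) : int := numq (val s).
Definition slope_den (s : slope) : int := denq (val s).

Lemma slope_num_gt0 (s : slope) : 0 < slope_num s.
Proof. by rewrite numq_gt0; exact: valP s. Qed.

Lemma slope_den_gt0 (s : slope) : 0 < slope_den s.
Proof. exact: denq_gt0. Qed.

Lemma frac_gt0 (m n : int) : 0 < m -> 0 < n -> 0 < m%:Q / n%:Q.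
Proof. by move=> m0 n0; rewrite divr_gt0 ?ltr0z. Qed.

Definition mk_slope (q p : int) (q0 : 0 < q) (p0 : 0 < p) : slope :=
  exist (fun x : rat => 0 < x) (q%:Q / p%:Q) (frac_gt0 q0 p0).

Definition sigma (s : slope) : slope :=
  mk_slope (slope_den_gt0 s) (slope_num_gt0 s).

Definition tau (s : slope) : slope :=
  mk_slope (slope_num_gt0 s) (addr_gt0 (slope_den_gt0 s) (slope_num_gt0 s)).

Definition fib : slope -> slope := sigma \o tau.

Definition slope1 : slope := mk_slope (@ltr01 int) (@ltr01 int).

(* Indexed so that F 0 = F 1 = 1. *)
Fixpoint F (k : nat) : nat :=
  match k with
  | 0 => 1
  | k'.+1 => match k' with 0 => 1 | k''.+1 => F k' + F k'' end
  end%N.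

(* Main.v *)
(* On values, sigma is x |-> 1/x and tau is x |-> x/(1+x), so fib is
   x |-> 1 + 1/x, which sends F_(k+1)/F_k to (F_k + F_(k+1))/F_(k+1). *)
Require Import Defs.
From mathcomp Require Import all_boot all_order all_algebra.
Import GRing.Theory Num.Theory.
Local Open Scope ring_scope.

(** Slopes are compared as rationals, so reduced forms need no tracking: [val_fib] turns [fib] into
    x |-> 1 + 1/x, and induction on [k] reduces to the Fibonacci recurrence. *)

Lemma val_sigma (s : slope) : val (sigma s) = (val s)^-1.
Proof. by rewrite /= -[in RHS](divq_num_den (val s)) invf_div. Qed.

Lemma val_tau (s : slope) : val (tau s) = val s / (1 + val s).
Proof.
have d0 : (slope_den s)%:Q != 0 by rewrite intr_eq0 lt0r_neq0 ?slope_den_gt0.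
have eq_s : val s = (slope_num s)%:Q / (slope_den s)%:Q.
  by rewrite divq_num_den.
(* The numerator here is the denominator built by [tau]; [slope_den s] then cancels. *)
have -> : 1 + val s = (slope_den s + slope_num s)%:Q / (slope_den s)%:Q.
  by rewrite eq_s intrD mulrDl divff.
by rewrite eq_s invf_div mulrA divfK.
Qed.

Lemma val_fib (s : slope) : val (fib s) = 1 + (val s)^-1.
Proof.
have s0 : val s != 0 by apply: lt0r_neq0; exact: valP.
by rewrite val_sigma val_tau invf_div mulrDl mul1r divff // addrC.
Qed.

Lemma F_SS k : F k.+2 = (F k.+1 + F k)%N.
Proof. by []. Qed.

Lemma F_gt0 k : (0 < F k)%N.
Proof. by elim: k => [|[|k] IHk] //; rewrite F_SS addn_gt0 IHk. Qed.

Theorem theorem3p1 (k : nat) (hk : (1 <= k)%N) :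
  val (iter k fib slope1) = (F k.+1)%:R / (F k)%:R :> rat.
Proof.
clear hk; elim: k => [|k IHk] //.
have F0 : (F k.+1)%:R != 0 :> rat by rewrite pnatr_eq0 -lt0n F_gt0.
(* Both sides become 1 + F_k/F_(k+1). *)
by rewrite iterS val_fib IHk invf_div F_SS natrD mulrDl divff.
Qed.
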